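(* Let $\mathcal{X}$ be a finite vocabulary, $\mathcal{M}_s$ and $\mathcal{M}_b$ arbitrary autoregressive distributions over $\mathcal{X}$, $X_0$ a prefix, $\gamma\ge 1$, and let the decoding tree be a single chain $T=(\alpha_0,\alpha_1,\dots,\alpha_\gamma)$ with $\alpha_0=X_0$ and $\alpha_i\sim\mathcal{M}_s(\cdot\mid\alpha_0,\dots,\alpha_{i-1})$ for $1\le i\le\gamma$. Let VERIFY be any valid chain verification algorithm, and let $N_{\rm traversal}$, $N_{\rm block}$ and $N_{\rm verify}$ be the number of accepted tokens in Traversal Verification, Block Verification and VERIFY, respectively, applied to $(T,\mathcal{M}_s,\mathcal{M}_b)$. Then $$\mathbb{E}[N_{\rm traversal}]=\mathbb{E}[N_{\rm block}]\geq\mathbb{E}[N_{\rm verify}],$$ where $\mathbb{E}$ is the expectation over the randomness of the draft chain $T$ and the internal random variables of the verification algorithms.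
   Context: **Models.** $\mathcal{X}$ is a finite set of tokens. An autoregressive distribution $\mathcal{M}$ assigns to each finite sequence $x^i=(x_0,x_1,\dots,x_i)$ (with $x_0=X_0$ the fixed prefix and $x_1,\dots,x_i\in\mathcal{X}$) a probability distribution $\mathcal{M}(\cdot\mid x^i)$ on $\mathcal{X}$. Write $\alpha^i=(\alpha_0,\dots,\alpha_i)$ and $[t]_+=\max\{t,0\}$. **Chain verification algorithm.** A (randomized) procedure that takes the chain $T=(\alpha_0,\dots,\alpha_\gamma)$, the distributions $\mathcal{M}_s(\cdot\mid\alpha^i)$ for $i<\gamma$ and $\mathcal{M}_b(\cdot\mid\alpha^i)$ for $i\le\gamma$, and outputs an accepted prefix $X^\tau=\alpha^\tau$ of the chain, $0\le\tau\le\gamma$, and one additional token $Y\in\mathcal{X}$. The number of accepted tokens is $N=\tau$. The algorithm is *valid* if $(X^\tau,Y)\sim\mathcal{M}_b(\cdot\mid X_0)$, in the following sense: if $(X^\tau,Y)$ is continued autoregressively by sampling from $\mathcal{M}_b(\cdot\mid X^\tau,Y)$ (given $(X^\tau,Y)$, independently of everything else) to a sequence $(Z_0,Z_1,\dots)$ with $Z_0=X_0$, then for every $n\ge 1$ and all $z_1,\dots,z_n\in\mathcal{X}$, $\mathbb{P}(Z_1=z_1,\dots,Z_n=z_n)=\prod_{i=1}^n\mathcal{M}_b(z_i\mid X_0,z_1,\dots,z_{i-1})$. **Traversal Verification on a chain.** Set $p_0=1$ and $p_i=\min\{p_{i-1}\mathcal{M}_b(\alpha_i\mid\alpha^{i-1})/\mathcal{M}_s(\alpha_i\mid\alpha^{i-1}),1\}$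 for $1\le i\le\gamma$; set $B_i=\mathcal{M}_b(\cdot\mid\alpha^i)$ for $0\le i\le\gamma$. Start with $i=\gamma$ and repeat: sample a fresh independent $\eta\sim U(0,1)$. If $\eta<p_i$, set $\tau=i$, sample $Y$ from $B_i$, and output $(\alpha^\tau,Y)$. Otherwise (node $\alpha_i$ is deleted), with $S=\sum_{x\in\mathcal{X}}[p_{i-1}\mathcal{M}_b(x\mid\alpha^{i-1})-\mathcal{M}_s(x\mid\alpha^{i-1})]_+$, replace $$B_{i-1}(x)\leftarrow\frac{[p_{i-1}\mathcal{M}_b(x\mid\alpha^{i-1})-\mathcal{M}_s(x\mid\alpha^{i-1})]_+}{S},\qquad p_{i-1}\leftarrow\frac{S}{S+1-p_{i-1}},$$ and continue with $i-1$ in place of $i$. Conventions: if $S=0$, $B_{i-1}$ is left unchanged, and if moreover $p_{i-1}=1$ then $p_{i-1}$ is left equal to $1$; hence $p_0=1$ always and the procedure stops at $i=0$ at the latest, almost surely. **Block Verification.** Define $p_0,\dots,p_\gamma$ by the same initial recursion $p_0=1$, $p_i=\min\{p_{i-1}\mathcal{M}_b(\alpha_i\mid\alpha^{i-1})/\mathcal{M}_s(\alpha_i\mid\alpha^{i-1}),1\}$. Put $h_\gamma=p_\gamma$ and, for $1\le i<\gamma$, $$h_i=\frac{S_i}{S_i+1-p_i},\qquad S_i=\sum_{x\in\mathcal{X}}[p_i\mathcal{M}_b(x\mid\alpha^i)-\mathcal{M}_s(x\mid\alpha^i)]_+$$ (with $h_i=1$ if $S_i=0$ and $p_i=1$). Sample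 independent $\eta_1,\dots,\eta_\gamma\sim U(0,1)$ and let $\tau$ be the largest $i\in\{1,\dots,\gamma\}$ with $\eta_i\le h_i$, or $\tau=0$ if there is none. If $\tau=\gamma$, sample $Y$ from $\mathcal{M}_b(\cdot\mid\alpha^\gamma)$; otherwise sample $Y$ from the distribution proportional to $[p_\tau\mathcal{M}_b(\cdot\mid\alpha^\tau)-\mathcal{M}_s(\cdot\mid\alpha^\tau)]_+$ (if this is identically zero, which has probability zero of being needed, sample from $\mathcal{M}_b(\cdot\mid\alpha^\tau)$). Output $(\alpha^\tau,Y)$. *)

(* Defs.v *)
From mathcomp Require Import all_boot all_order all_algebra.
From mathcomp Require Import all_classical all_reals all_analysis.

Set Implicit Arguments.
Unset Strict Implicit.
Unset Printing Implicit Defensive.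

Import Order.TTheory GRing.Theory Num.Theory.
Import numFieldNormedType.Exports.
Local Open Scope ring_scope.

(* Probability distributions on a finite type. *)

Record fdist (R : realType) (A : finType) := FDist {
  pmf :> A -> R;
  pmf_ge0 : forall a, 0 <= pmf a;
  pmf_sum1 : \sum_a pmf a = 1 }.

Section fdist_theory.
Context {R : realType}.

Lemma dret_ge0 (A : finType) (a b : A) : 0 <= (b == a)%:R :> R.
Proof. exact: ler0n. Qed.

Lemma dret_sum1 (A : finType) (a : A) : \sum_b (b == a)%:R = 1 :> R.
Proof.
by rewrite (bigD1 a) //= eqxx big1 ?addr0 // => b /negPf ->.
Qed.

Definition dret (A : finType) (a : A) : fdist R A :=
  FDist (dret_ge0 a) (dret_sum1 a).

Lemma dbind_ge0 (A B : finType) (p : fdist R A) (f : A -> fdist R B) b :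
  0 <= \sum_a p a * f a b.
Proof. by apply: sumr_ge0 => a _; apply: mulr_ge0; apply: pmf_ge0. Qed.

Lemma dbind_sum1 (A B : finType) (p : fdist R A) (f : A -> fdist R B) :
  \sum_b \sum_a p a * f a b = 1.
Proof.
rewrite exchange_big /= -[RHS](pmf_sum1 p); apply: eq_bigr => a _.
by rewrite -mulr_sumr pmf_sum1 mulr1.
Qed.

Definition dbind (A B : finType) (p : fdist R A) (f : A -> fdist R B) :
  fdist R B := FDist (dbind_ge0 p f) (dbind_sum1 p f).

Definition dmap (A B : finType) (f : A -> B) (p : fdist R A) : fdist R B :=
  dbind p (fun a => dret (f a)).

Lemma dprod_ge0 (I A : finType) (p : I -> fdist R A) (f : {ffun I -> A}) :
  0 <= \prod_i p i (f i).
Proof. by apply: prodr_ge0 => i _; apply: pmf_ge0. Qed.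

Lemma dprod_sum1 (I A : finType) (p : I -> fdist R A) :
  \sum_(f : {ffun I -> A}) \prod_i p i (f i) = 1.
Proof.
rewrite -(bigA_distr_bigA (fun i a => p i a)) /=.
by apply: big1 => i _; rewrite pmf_sum1.
Qed.

(* joint law of independent variables with laws [p i] *)
Definition dprod (I A : finType) (p : I -> fdist R A) :
  fdist R {ffun I -> A} :=
  FDist (@dprod_ge0 I A p) (dprod_sum1 p).

(* [dunif A] is the law of the truth value of [eta \in A], eta ~ U(0,1). *)

Definition U01 : probability (measurableTypeR R) R := uniform_prob (@ltr01 R).

Definition dunif_pmf (A : set R) (b : bool) : R :=
  fine (U01 (if b then A else ~` A)%classic).

Lemma dunif_ge0 (A : set R) b : 0 <= dunif_pmf A b.
Proof. by apply: fine_ge0; apply: measure_ge0. Qed.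

Lemma dunif_sum1 (A : set R) (mA : measurable A) : \sum_b dunif_pmf A b = 1.
Proof.
have := fin_num_measure U01 A mA.
rewrite big_bool /dunif_pmf (probability_setC U01 mA).
by move=> /fineK <- /=; rewrite addrC subrK.
Qed.

Definition dunif (A : set R) (mA : measurable A) : fdist R bool :=
  FDist (dunif_ge0 A) (dunif_sum1 mA).

Definition unif_lt (p : R) : fdist R bool :=
  @dunif [set` `]-oo, p[ ] (measurable_itv _).

Definition unif_le (p : R) : fdist R bool :=
  @dunif [set` `]-oo, p] ] (measurable_itv _).

End fdist_theory.

(* Autoregressive distributions: [M c] is the law of the token following the
   token sequence [c], which includes the prefix. *)

Definition model (R : realType) (X : finType) := seq X -> fdist R X.

(* probability that sampling n tokens from M after the prefix c gives z *)
Definition path_prob (R : realType) (X : finType) (M : model R X) (c : seq X)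
    (n : nat) (z : n.-tuple X) : R :=
  \prod_(i < n) M (c ++ take i z) (tnth z i).

(* Probability that the first n tokens after c are z, when the sequence starts
   with the forced tokens w and is then continued by sampling from M. *)
Definition continue_prob (R : realType) (X : finType) (M : model R X)
    (c w : seq X) (n : nat) (z : n.-tuple X) : R :=
  \prod_(i < n) (if onth w i is Some y then (tnth z i == y)%:R
                 else M (c ++ take i z) (tnth z i)).

(* The output (tau, y) stands for the accepted prefix alpha^tau and the extra
   token y. *)
Definition output (X : finType) (g : nat) : finType := ('I_g.+1 * X)%type.

(* A randomized procedure, given by the law of its output. The arguments are
   alpha_0 = X_0, the drafted tokens (alpha_1, ..., alpha_g) -- so that
   [tnth T i] is alpha_(i+1) --, the laws Ms(.|alpha^i) for i < g and the laws
   Mb(.|alpha^i) for i <= g. *)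
Definition chain_algorithm (R : realType) (X : finType) (g : nat) :=
  seq X -> g.-tuple X -> g.-tuple (fdist R X) -> g.+1.-tuple (fdist R X) ->
  fdist R (output X g).

Section verification.
Context {R : realType} {X : finType}.
Implicit Types (Ms Mb : model R X) (g : nat).

Definition run Ms Mb (X0 : seq X) g (A : chain_algorithm R X g) (T : g.-tuple X) :
    fdist R (output X g) :=
  A X0 T [tuple Ms (X0 ++ take i T) | i < g]
         [tuple Mb (X0 ++ take i T) | i < g.+1].

Definition valid Ms Mb (X0 : seq X) g (A : chain_algorithm R X g) : Prop :=
  forall (n : nat) (z : n.-tuple X), (0 < n)%N ->
    \sum_(T : g.-tuple X) path_prob Ms X0 T *
      (\sum_(o : output X g) run Ms Mb X0 A T o *
         continue_prob Mb X0 (rcons (take o.1 T) o.2) z)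
    = path_prob Mb X0 z.

(* E[N], over the draft T ~ Ms and the randomness of the algorithm *)
Definition expected_accepted Ms Mb (X0 : seq X) g
    (A : chain_algorithm R X g) : R :=
  \sum_(T : g.-tuple X) path_prob Ms X0 T *
    (\sum_(o : output X g) run Ms Mb X0 A T o * (o.1 : nat)%:R).

Section residual.
Variables (p : R) (b q : fdist R X).

(* [p * b x - q x]_+ *)
Definition excess (x : X) : R := Num.max (p * b x - q x) 0.

Definition excess_sum : R := \sum_x excess x.

Definition residual_pmf (x : X) : R :=
  if excess_sum == 0 then b x else excess x / excess_sum.

Lemma residual_ge0 x : 0 <= residual_pmf x.
Proof.
have ge0 y : 0 <= excess y by rewrite /excess le_max lexx orbT.
rewrite /residual_pmf; case: ifP => _; first exact: pmf_ge0.
by apply: divr_ge0 => //; apply: sumr_ge0.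
Qed.

Lemma residual_sum1 : \sum_x residual_pmf x = 1.
Proof.
rewrite /residual_pmf; case: eqP => [_|/eqP S0]; first exact: pmf_sum1.
by rewrite -mulr_suml divff.
Qed.

Definition residual : fdist R X := FDist residual_ge0 residual_sum1.

Definition residual_weight : R :=
  if (excess_sum == 0) && (p == 1) then 1
  else excess_sum / (excess_sum + 1 - p).

End residual.

Section algorithms.
Variables (g : nat) (T : g.-tuple X).
Variables (ms : g.-tuple (fdist R X)) (mb : g.+1.-tuple (fdist R X)).

(* Nat-indexed access; the default value is never used below. *)
Definition ms_at (i : nat) : fdist R X := nth (thead mb) ms i.
Definition mb_at (i : nat) : fdist R X := nth (thead mb) mb i.

(* [ratios`_i] is Mb(alpha_(i+1)|alpha^i) / Ms(alpha_(i+1)|alpha^i). *)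
Definition ratios : g.-tuple R :=
  [tuple mb_at i (tnth T i) / ms_at i (tnth T i) | i < g].

Fixpoint p_init (i : nat) : R :=
  if i is j.+1 then Num.min (p_init j * ratios`_j) 1 else 1.

(* Here p and B are the current values of p_i and B_i; the values at nodes
   below i are still the initial ones. Node 0 is accepted without a test: its
   weight is always 1, so that eta < 1 holds almost surely. *)
Fixpoint traversal_from (i : nat) (p : R) (B : fdist R X) :
    fdist R (output X g) :=
  if i is j.+1 then
    dbind (unif_lt p) (fun accept : bool =>
      if accept then dmap (fun y => (inord i, y)) B
      else traversal_from j
             (residual_weight (p_init j) (mb_at j) (ms_at j))
             (residual (p_init j) (mb_at j) (ms_at j)))
  else dmap (fun y => (ord0, y)) B.

Definition traversal_on : fdist R (output X g) :=
  traversal_from g (p_init g) (mb_at g).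

Definition block_h (i : nat) : R :=
  if i == g then p_init g
  else residual_weight (p_init i) (mb_at i) (ms_at i).

(* [a i] is the truth value of eta_(i+1) <= h_(i+1). *)
Definition block_tau (a : {ffun 'I_g -> bool}) : nat :=
  \max_(i < g | a i) i.+1.

Definition block_on : fdist R (output X g) :=
  dbind (dprod (fun i : 'I_g => unif_le (block_h i.+1))) (fun a =>
    let tau := block_tau a in
    dmap (fun y => (inord tau, y))
      (if tau == g then mb_at g
       else residual (p_init tau) (mb_at tau) (ms_at tau))).

End algorithms.

Definition traversal_verification (g : nat) : chain_algorithm R X g :=
  fun _ T ms mb => traversal_on T ms mb.

Definition block_verification (g : nat) : chain_algorithm R X g :=
  fun _ T ms mb => block_on T ms mb.

End verification.

Arguments traversal_verification {R X} g.
Arguments block_verification {R X} g.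

(* Main.v *)
Require Import Defs.
From mathcomp Require Import all_boot all_order all_algebra.
From mathcomp Require Import all_classical all_reals all_analysis.
From mathcomp Require Import ring lra.
Import Order.TTheory GRing.Theory Num.Theory.
Local Open Scope ring_scope.

Set Implicit Arguments.
Unset Strict Implicit.
Unset Printing Implicit Defensive.

(* E[N] is the sum over l >= 1 of P(tau >= l). For a valid algorithm, let a(z)
   be the probability that z, of length l, is an accepted prefix of the draft.
   Then a(z) <= Ms(z), and validity at the lengths l and l + 1 gives
   a(zx) <= a(z) Mb(x|z), because the tokens after the output are drawn from
   Mb. By induction a(z) <= Ms(z) p_l(z), since Ms(z) p_l(z) satisfies the same
   recursion with a minimum of the two bounds.
   Both Traversal and Block Verification attain this bound: given the draft,
   tau >= l has probability
     1 - (1 - h_l) ... (1 - h_(g-1)) (1 - p_g),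
   and this expression is a martingale in g, because h_i is precisely the
   number with (1 - h_i) (1 - E[p_(i+1) | alpha^i]) = 1 - p_i; its value at
   g = l is p_l. *)

(** * Bernoulli laws obtained by thresholding a uniform variable *)

Section uniform.
Context {R : realType}.
Implicit Types p : R.

Lemma U01E (A : set (measurableTypeR R)) : measurable A ->
  U01 A = lebesgue_measure (A `&` `[0%R, 1%R])%classic.
Proof.
move=> mA; rewrite /U01 /= /uniform_prob integral_uniform_pdf.
rewrite (eq_integral (fun=> 1%E)); last first.
  move=> x; rewrite inE /= in_itv /= /uniform_pdf => -[_ ->].
  by rewrite subr0 invr1.
by rewrite integral_cst ?mul1e //; apply: measurableI => //; exact: measurable_itv.
Qed.

Lemma unif_ltE p : 0 <= p <= 1 -> unif_lt p true = p.
Proof.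
move=> /andP[p0 p1]; rewrite /unif_lt /= /dunif_pmf U01E; last exact: measurable_itv.
rewrite (_ : _ `&` _ = `[0%R, p[)%classic; last first.
  apply/seteqP; split => x /=; rewrite !in_itv /=.
    by move=> [? /andP[-> _]].
  by move=> /andP[-> xp]; split=> //; apply: ltW (lt_le_trans xp p1).
rewrite lebesgue_measure_itv /= lte_fin.
by case: ltgtP p0 => //= _ _; rewrite subr0.
Qed.

Lemma unif_leE p : 0 <= p <= 1 -> unif_le p true = p.
Proof.
move=> /andP[p0 p1]; rewrite /unif_le /= /dunif_pmf U01E; last exact: measurable_itv.
rewrite (_ : _ `&` _ = `[0%R, p])%classic; last first.
  apply/seteqP; split => x /=; rewrite !in_itv /=.
    by move=> [? /andP[-> _]].
  by move=> /andP[-> xp]; split=> //; apply: le_trans xp p1.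
rewrite lebesgue_measure_itv /= lte_fin.
by case: ltgtP p0 => //= _ _; rewrite subr0.
Qed.

End uniform.

(** * Expectations under finite distributions *)

Section expectation.
Context {R : realType}.

Definition dexp (A : finType) (p : fdist R A) (F : A -> R) : R :=
  \sum_a p a * F a.

Lemma eq_dexp (A : finType) (p : fdist R A) (F G : A -> R) :
  F =1 G -> dexp p F = dexp p G.
Proof. by move=> FG; apply: eq_bigr => a _; rewrite FG. Qed.

Lemma dexp_cst (A : finType) (p : fdist R A) (c : R) : dexp p (fun=> c) = c.
Proof. by rewrite /dexp -mulr_suml Defs.pmf_sum1 mul1r. Qed.

Lemma dexp_dret (A : finType) (a : A) (F : A -> R) : dexp (dret a) F = F a.
Proof.
rewrite /dexp (bigD1 a) //= eqxx mul1r big1 ?addr0 // => b /negPf ->.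
by rewrite mul0r.
Qed.

Lemma dexp_dbind (A B : finType) (p : fdist R A) (f : A -> fdist R B)
  (F : B -> R) : dexp (dbind p f) F = dexp p (fun a => dexp (f a) F).
Proof.
rewrite /dexp /=; under eq_bigr do rewrite mulr_suml.
rewrite exchange_big /=; apply: eq_bigr => a _; rewrite mulr_sumr.
by apply: eq_bigr => b _; rewrite mulrA.
Qed.

Lemma dexp_dmap (A B : finType) (p : fdist R A) (f : A -> B) (F : B -> R) :
  dexp (dmap f p) F = dexp p (F \o f).
Proof. by rewrite dexp_dbind; apply: eq_dexp => a; rewrite dexp_dret. Qed.

Lemma pmf_false (p : fdist R bool) : p false = 1 - p true.
Proof. by rewrite -(Defs.pmf_sum1 p) big_bool /= addrC addrK. Qed.

Lemma dexp_bool (p : fdist R bool) (F : bool -> R) :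
  dexp p F = p true * F true + (1 - p true) * F false.
Proof. by rewrite /dexp big_bool /= pmf_false. Qed.

Lemma dexp_compl (A : finType) (p : fdist R A) (F : A -> R) :
  dexp p (fun a => 1 - F a) = 1 - dexp p F.
Proof.
rewrite -[in RHS](Defs.pmf_sum1 p) /dexp -sumrB.
by apply: eq_bigr => a _; rewrite mulrBr mulr1.
Qed.

Lemma dexpZl (A : finType) (p : fdist R A) (c : R) (F : A -> R) :
  dexp p (fun a => c * F a) = c * dexp p F.
Proof. by rewrite /dexp mulr_sumr; apply: eq_bigr => a _; rewrite mulrCA. Qed.

Lemma dexp_dprod (I A : finType) (p : I -> fdist R A) (F : I -> A -> R) :
  dexp (dprod p) (fun f => \prod_i F i (f i)) = \prod_i dexp (p i) (F i).
Proof.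
rewrite /dexp bigA_distr_bigA /=.
by apply: eq_bigr => f _; rewrite big_split.
Qed.

End expectation.

(** * Residual mass and the balance equation for the acceptance rate *)

Section residual_weight.
Context {R : realType} {X : finType}.
Implicit Types (p : R) (b q : fdist R X).

Lemma excess_sum_ge0 p b q : 0 <= excess_sum p b q.
Proof. by apply: sumr_ge0 => x _; rewrite /excess le_max lexx orbT. Qed.

Lemma residual_weight_itv p b q : p <= 1 -> 0 <= residual_weight p b q <= 1.
Proof.
move=> p1; rewrite /residual_weight; case: ifP => [_|_]; first by rewrite ler01 lexx.
have S0 := excess_sum_ge0 p b q; set S := excess_sum p b q in S0 *.
have D0 : 0 <= S + 1 - p by rewrite -addrA addr_ge0 // subr_ge0.
(* A zero denominator belongs to the case already split off; the convention [0^-1 = 0] settles it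
   here without appealing to that. *)
rewrite divr_ge0 //=; have [->|Dn0] := eqVneq (S + 1 - p) 0.
  by rewrite invr0 mulr0 ler01.
by rewrite ler_pdivrMr ?lt_neqAle 1?eq_sym ?Dn0 // mul1r -addrA lerDl subr_ge0.
Qed.

(* [p - excess_sum p b q] is the expected weight of the next node, since
   q x * min (p * b x / q x) 1 = p * b x - [p * b x - q x]_+. *)
Lemma residual_weight_balance p b q : p <= 1 ->
  (1 - residual_weight p b q) * (1 - (p - excess_sum p b q)) = 1 - p.
Proof.
move=> p1; rewrite /residual_weight; case: ifP => [/andP[/eqP -> /eqP ->]|].
  by rewrite subrr mul0r.
have S0 := excess_sum_ge0 p b q; set S := excess_sum p b q in S0 *.
(* The denominator is the sum of [S >= 0] and [1 - p >= 0], so it vanishes only in the excluded case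
   [S = 0], [p = 1]. *)
move=> Sp; have Dn0 : S + 1 - p != 0.
  apply/eqP => D0; have Se : S = 0 by lra.
  have pe : p = 1 by lra.
  by rewrite Se pe !eqxx in Sp.
by field.
Qed.

Lemma sum_min_ratio p b q : 0 <= p ->
  \sum_x q x * Num.min (p * (b x / q x)) 1 = p - excess_sum p b q.
Proof.
move=> p0; have -> : p - excess_sum p b q = \sum_x (p * b x - excess p b q x).
  by rewrite sumrB -mulr_sumr Defs.pmf_sum1 mulr1.
apply: eq_bigr => x _; rewrite /excess.
(* If [q x = 0], the value of the ratio is irrelevant: the left term is zero, and the excess is all
   of [p * b x]. *)
have [q0|qn0] := eqVneq (q x) 0.
  rewrite q0 mul0r subr0 max_l ?subrr //; apply: mulr_ge0 => //; exact: Defs.pmf_ge0.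
have q0 : 0 < q x by rewrite lt_neqAle eq_sym qn0 Defs.pmf_ge0.
rewrite minr_pMr ?(ltW q0) // mulr1 (_ : q x * (p * (b x / q x)) = p * b x); last by field.
by rewrite /Num.min /Num.max; case: ifP; case: ifP => ? ?; lra.
Qed.

End residual_weight.

(** * Tail probabilities of both algorithms for a fixed draft *)

Section tails.
Context {R : realType} {X : finType} {g : nat}.
Variables (T : g.-tuple X) (ms : g.-tuple (fdist R X)) (mb : g.+1.-tuple (fdist R X)).

Local Notation p_ := (p_init T ms mb).
Local Notation h_ i := (residual_weight (p_ i) (mb_at mb i) (ms_at ms mb i)).

Lemma p_init_itv i : 0 <= p_ i <= 1.
Proof.
elim: i => [|i /andP[p0 _]] /=; first by rewrite ler01 lexx.
rewrite ge_min lexx orbT andbT le_min ler01 andbT mulr_ge0 //.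
have [ig|gi] := ltnP i g; last by rewrite (@nth_default _ 0 (ratios T ms mb)) ?size_tuple ?lexx.
by rewrite /ratios (nth_mktuple _ _ (Ordinal ig)); apply: divr_ge0; apply: Defs.pmf_ge0.
Qed.

(** For [l <= i], fewer than [l] tokens are accepted exactly when the tests at [i, ..., l] all fail:
    the one at [i] succeeds with probability [p], each later one with [h_ j]. The induction needs
    arbitrary [p] and [B], since a rejection replaces both. *)
Lemma traversal_tail l i (p : R) B : 0 <= p <= 1 -> (i <= g)%N -> (0 < l)%N ->
  dexp (traversal_from T ms mb i p B) (fun o => (l <= o.1)%N%:R) =
  if (l <= i)%N then 1 - (\prod_(l <= j < i) (1 - h_ j)) * (1 - p) else 0.
Proof.
elim: i p B => [|i IHi] p B pitv ig l0 /=.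
  rewrite dexp_dmap leqNgt l0 -[RHS](dexp_cst B).
  by apply: eq_dexp => y /=; rewrite leqNgt l0.
rewrite dexp_dbind dexp_bool unif_ltE // dexp_dmap.
rewrite (eq_dexp _ (G := fun=> (l <= i.+1)%N%:R)) ?dexp_cst; last first.
  by move=> y /=; rewrite inordK.
rewrite IHi ?(ltnW ig) //; last by apply: residual_weight_itv; case/andP: (p_init_itv i).
have [li|] := leqP l i; first by rewrite (leqW li) big_nat_recr //=; ring.
rewrite leq_eqVlt => /orP[/eqP <-|il]; last by rewrite leqNgt il /= !mulr0 addr0.
by rewrite leqnn big_geq //= mulr0 addr0 mul1r mulr1 subKr.
Qed.

Lemma block_tau_le a : (block_tau (g := g) a <= g)%N.
Proof. by apply/bigmax_leqP => i _; exact: ltn_ord. Qed.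

(** [tau < l] means that every test at a node [>= l] fails; by independence the failure
    probabilities multiply, as they do for traversal. *)
Lemma block_tail l : (0 < l <= g)%N ->
  dexp (block_on T ms mb) (fun o => (l <= o.1)%N%:R) =
  1 - (\prod_(l <= j < g) (1 - h_ j)) * (1 - p_ g).
Proof.
move=> /andP[l0 lg]; rewrite /block_on dexp_dbind.
rewrite (eq_dexp _ (G := fun a => (l <= block_tau (g := g) a)%N%:R)); last first.
  move=> a; rewrite dexp_dmap /=.
  rewrite (eq_dexp _ (G := fun=> (l <= block_tau (g := g) a)%N%:R)) ?dexp_cst //.
  by move=> y /=; rewrite inordK // ltnS block_tau_le.
(* Factors with [i.+1 < l] are constantly 1, so the product over all [i] is the indicator of
   [tau < l] and has the form required by [dexp_dprod]. *)
pose none (i : 'I_g) b := (~~ ((l <= i.+1)%N && b))%:R : R.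
have tau_lt (a : {ffun 'I_g -> bool}) :
    (l <= block_tau a)%N%:R = 1 - \prod_i none i (a i).
  have [[i ai li]|no] := pselect (exists2 i, a i & (l <= i.+1)%N).
    have -> : (l <= block_tau a)%N.
      by apply: leq_trans li _; rewrite /block_tau (bigD1 i) //= leq_maxl.
    by rewrite (bigD1 i) //= /none ai li mul0r subr0.
  rewrite big1 => [|i _]; last first.
    by rewrite /none; case: andP => // -[li ai]; case: no; exists i.
  rewrite subrr (_ : (l <= _)%N = false) //; apply/negbTE.
  rewrite -ltnNge -(prednK l0) ltnS; apply/bigmax_leqP => i ai.
  by rewrite -ltnS (prednK l0) ltnNge; apply/negP => li; case: no; exists i.
rewrite (eq_dexp _ tau_lt) dexp_compl dexp_dprod; congr (1 - _).
have dexp_none (i : 'I_g) :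
    dexp (unif_le (block_h T ms mb i.+1)) (none i) =
    if (l <= i.+1)%N then 1 - block_h T ms mb i.+1 else 1.
  have hitv : 0 <= block_h T ms mb i.+1 <= 1.
    rewrite /block_h; case: eqP => _; first exact: p_init_itv.
    by apply: residual_weight_itv; case/andP: (p_init_itv i.+1).
  rewrite dexp_bool unif_leE // /none andbT andbF.
  by case: ifP => _ /=; rewrite ?mulr0 ?mulr1 ?add0r // addrC subrK.
under eq_bigr do rewrite dexp_none.
(* Test [i] belongs to node [i.+1]; reindexing by nodes isolates the factor at [g], the only one
   where [block_h] is [p_init] itself. *)
transitivity (\prod_(l <= j < g.+1) (1 - block_h T ms mb j)).
  rewrite -big_mkcond -[in RHS](prednK l0) big_add1 big_geq_mkord.
  by apply: eq_bigl => i; rewrite -[(l.-1 <= i)%N]ltnS prednK.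
rewrite big_nat_recr //= {2}/block_h eqxx; congr (_ * _).
by apply: eq_big_nat => j /andP[_ jg]; rewrite /block_h ltn_eqF.
Qed.

End tails.

(** * Path probabilities and averages over sampled paths *)

Section paths.
Context {R : realType} {X : finType}.
Variable M : model R X.
Implicit Types (c s w : seq X) (x : X).

(** A form of [continue_prob] on plain sequences, so that strings of different lengths can be
    compared and extended by one token. *)
Fixpoint forced_prob c w s : R :=
  if s is x :: s' then
    (if onth w 0 is Some y then (x == y)%:R else M c x) *
      forced_prob (rcons c x) (behead w) s'
  else 1.

Lemma continue_probE n c w (z : n.-tuple X) :
  continue_prob M c w z = forced_prob c w z.
Proof.
elim: n c w z => [|n IHn] c w z; first by rewrite tuple0 /continue_prob big_ord0.
case/tupleP: z => x z; rewrite /= -IHn /continue_prob big_ord_recl /= tnth0 cats0.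
congr (_ * _); apply: eq_bigr => i _.
rewrite (_ : tnth _ (lift _ _) = tnth z i); last by rewrite !(tnth_nth x).
by case: w => [|y w] /=; rewrite ?onth0n cat_rcons.
Qed.

Definition seq_prob c s := forced_prob c [::] s.

Lemma path_probE n c (z : n.-tuple X) : path_prob M c z = seq_prob c z.
Proof.
rewrite /seq_prob -continue_probE; apply: eq_bigr => i _.
by rewrite onth0n.
Qed.

Lemma forced_prob_rcons c w s x :
  forced_prob c w (rcons s x) = forced_prob c w s *
    (if onth w (size s) is Some y then (x == y)%:R else M (c ++ s) x).
Proof.
elim: s c w => [|y s IHs] c w /=; first by rewrite cats0 mulr1 mul1r.
rewrite IHs mulrA cat_rcons; congr (_ * _).
by case: w => [|z w] //=; rewrite onth0n.
Qed.

Lemma forced_prob_take c w s : (size s <= size w)%N ->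
  forced_prob c w s = (take (size s) w == s)%:R.
Proof.
elim: s c w => [|x s IHs] c [|y w] //= sw.
by rewrite IHs // eqseq_cons eq_sym -natrM mulnb.
Qed.

Lemma forced_prob_ge0 c w s : 0 <= forced_prob c w s.
Proof.
elim: s c w => //= x s IHs c w; apply: mulr_ge0 => //.
by case: w => [|y w]; [exact: Defs.pmf_ge0 | exact: ler0n].
Qed.

Lemma seq_prob_rcons c s x : seq_prob c (rcons s x) = seq_prob c s * M (c ++ s) x.
Proof. by rewrite /seq_prob forced_prob_rcons onth0n. Qed.

Lemma sum_tuple_rcons n (F : seq X -> R) :
  \sum_(T : n.+1.-tuple X) F T = \sum_(T : n.-tuple X) \sum_x F (rcons T x).
Proof.
rewrite pair_big /= (reindex (fun u : n.-tuple X * X => rcons_tuple u.1 u.2)) //.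
apply: onW_bij; apply: inj_card_bij.
  by move=> [s x] [t y] /(congr1 val)/= /rcons_inj[/val_inj -> ->].
by rewrite card_prod !card_tuple expnSr.
Qed.

Definition path_mean c n (F : seq X -> R) : R :=
  \sum_(T : n.-tuple X) seq_prob c T * F T.

(** Tower property: condition on the first [n] tokens. *)
Lemma path_meanS c n F :
  path_mean c n.+1 F = path_mean c n (fun s => \sum_x M (c ++ s) x * F (rcons s x)).
Proof.
rewrite /path_mean (sum_tuple_rcons _ (fun s => seq_prob c s * F s)).
apply: eq_bigr => T _; rewrite mulr_sumr.
by apply: eq_bigr => x _; rewrite seq_prob_rcons mulrA.
Qed.

Lemma eq_path_mean c n (F G : seq X -> R) :
  (forall s, size s = n -> F s = G s) -> path_mean c n F = path_mean c n G.
Proof. by move=> FG; apply: eq_bigr => T _; rewrite FG // size_tuple. Qed.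

(** Marginalization: each token after the first [l] sums out to 1. *)
Lemma path_mean_take c l n F : (l <= n)%N ->
  path_mean c n (fun s => F (take l s)) = path_mean c l F.
Proof.
elim: n => [|n IHn].
  rewrite leqn0 => /eqP ->.
  by apply: eq_path_mean => s /size0nil ->.
rewrite leq_eqVlt => /orP[/eqP <-|ln].
  by apply: eq_path_mean => s <-; rewrite take_size.
rewrite path_meanS -IHn //; apply: eq_path_mean => s sn.
under eq_bigr do rewrite -cats1 takel_cat ?sn //.
by rewrite -mulr_suml Defs.pmf_sum1 mul1r.
Qed.

End paths.

(** * The weights along a path and the martingale *)

Section weights.
Context {R : realType} {X : finType}.
Variables (Ms Mb : model R X) (X0 : seq X).
Implicit Types (s c : seq X) (p : R).

(** The initial recursion for [p_i] as a function of the path alone, free of the fixed draft length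
    built into [p_init]. *)
Fixpoint weight_from c p s : R :=
  if s is x :: s' then
    weight_from (rcons c x) (Num.min (p * (Mb c x / Ms c x)) 1) s'
  else p.

Definition weight s := weight_from X0 1 s.

Lemma weight_from_rcons c p s x :
  weight_from c p (rcons s x) =
  Num.min (weight_from c p s * (Mb (c ++ s) x / Ms (c ++ s) x)) 1.
Proof.
elim: s c p => [|y s IHs] c p /=; first by rewrite cats0.
by rewrite IHs cat_rcons.
Qed.

Lemma weight_rcons s x :
  weight (rcons s x) = Num.min (weight s * (Mb (X0 ++ s) x / Ms (X0 ++ s) x)) 1.
Proof. exact: weight_from_rcons. Qed.

Lemma weight_itv s : 0 <= weight s <= 1.
Proof.
elim/last_ind: s => [|s x /andP[w0 _]]; first by rewrite ler01 lexx.
rewrite weight_rcons ge_min lexx orbT andbT le_min ler01 andbT mulr_ge0 //.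
by apply: divr_ge0; apply: Defs.pmf_ge0.
Qed.

Definition accept_rate s := residual_weight (weight s) (Mb (X0 ++ s)) (Ms (X0 ++ s)).

(** The conditional tail probability common to both algorithms when [s] is the whole draft; letting
    the length of [s] vary gives the martingale. *)
Definition accept_tail l s :=
  1 - (\prod_(l <= j < size s) (1 - accept_rate (take j s))) * (1 - weight s).

(** Appending [x] adds a factor [1 - accept_rate s] that does not depend on [x]. The mean of the new
    weight is given by [sum_min_ratio], and [residual_weight_balance] restores [1 - weight s]. *)
Lemma accept_tail_step l s : (l <= size s)%N ->
  \sum_x Ms (X0 ++ s) x * accept_tail l (rcons s x) = accept_tail l s.
Proof.
move=> ls; rewrite -/(dexp _ (fun x => accept_tail l (rcons s x))) dexp_compl.
congr (1 - _); have /andP[w0 w1] := weight_itv s.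
rewrite (eq_dexp _ (G := fun x =>
  (\prod_(l <= j < size s) (1 - accept_rate (take j s))) * (1 - accept_rate s) *
     (1 - weight (rcons s x)))); last first.
  move=> x; rewrite size_rcons big_nat_recr //= -cats1 take_size_cat //.
  congr (_ * _ * _); apply: eq_big_nat => j /andP[_ js].
  by rewrite takel_cat // ltnW.
rewrite dexpZl dexp_compl -mulrA.
congr (_ * _); rewrite -(residual_weight_balance (Mb (X0 ++ s)) (Ms (X0 ++ s)) w1).
congr (_ * (1 - _)); rewrite -sum_min_ratio //.
by apply: eq_bigr => x _; rewrite weight_rcons.
Qed.

(** The martingale is followed down to length [l], where the product is empty and [accept_tail]
    reduces to [weight]. *)
Lemma path_mean_accept_tail l n : (l <= n)%N ->
  path_mean Ms X0 n (accept_tail l) = path_mean Ms X0 l weight.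
Proof.
elim: n => [|n IHn].
  rewrite leqn0 => /eqP ->; apply: eq_path_mean => s s0.
  by rewrite /accept_tail big_geq ?s0 // mul1r subKr.
rewrite leq_eqVlt => /orP[/eqP ->|ln].
  apply: eq_path_mean => s sn.
  by rewrite /accept_tail big_geq ?sn // mul1r subKr.
rewrite path_meanS -IHn //; apply: eq_path_mean => s sn.
by rewrite accept_tail_step // sn.
Qed.

(** Multiplying by the draft probability clears the ratio; the two arguments of the minimum match
    the two upper bounds on the accepted mass. *)
Lemma seq_prob_weight_rcons s x :
  seq_prob Ms X0 (rcons s x) * weight (rcons s x) =
  Num.min (seq_prob Ms X0 s * weight s * Mb (X0 ++ s) x)
          (seq_prob Ms X0 (rcons s x)).
Proof.
have /andP[w0 _] := weight_itv s.
have P0 : 0 <= seq_prob Ms X0 s by exact: forced_prob_ge0.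
rewrite seq_prob_rcons weight_rcons.
(* For a token of draft probability zero both sides vanish, whatever the ratio is. *)
have [->|qn0] := eqVneq (Ms (X0 ++ s) x) 0.
  by rewrite mulr0 mul0r min_r // !mulr_ge0 // Defs.pmf_ge0.
rewrite minr_pMr ?mulr_ge0 ?Defs.pmf_ge0 // mulr1.
by congr Num.min; field.
Qed.

Section access.
Variables (g : nat) (T : g.-tuple X).
Local Notation ms := [tuple Ms (X0 ++ take i T) | i < g].
Local Notation mb := [tuple Mb (X0 ++ take i T) | i < g.+1].

Lemma p_init_weight i : (i <= g)%N -> p_init T ms mb i = weight (take i T).
Proof.
elim: i => [|i IHi] ig; first by rewrite take0.
have x0 := tnth T (Ordinal ig).
rewrite /= IHi ?(ltnW ig) // /ratios (nth_mktuple _ _ (Ordinal ig)) /=.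
rewrite (take_nth x0) ?size_tuple // weight_rcons (tnth_nth x0) /mb_at /ms_at.
rewrite (nth_mktuple _ _ (Ordinal ig)).
by rewrite (nth_mktuple _ _ (Ordinal (ltnW ig : i < g.+1)%N)).
Qed.

Lemma accept_tailE l :
  1 - (\prod_(l <= j < g) (1 - residual_weight (p_init T ms mb j)
                                 (mb_at mb j) (ms_at ms mb j))) *
      (1 - p_init T ms mb g) = accept_tail l T.
Proof.
rewrite /accept_tail size_tuple p_init_weight // take_oversize ?size_tuple //.
congr (1 - _ * _); apply: eq_big_nat => j /andP[_ jg].
rewrite p_init_weight ?(ltnW jg) // /mb_at /ms_at.
rewrite (nth_mktuple _ _ (Ordinal jg)).
by rewrite (nth_mktuple _ _ (Ordinal (ltnW jg : j < g.+1)%N)).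
Qed.

End access.

End weights.

(** * The upper bound for valid algorithms *)

Section verification.
Context {R : realType} {X : finType}.
Variables (Ms Mb : model R X) (X0 : seq X) (g : nat).
Implicit Types (A : chain_algorithm R X g) (G H : seq X -> output X g -> R).

Definition draft_exp A G : R :=
  \sum_(T : g.-tuple X) path_prob Ms X0 T * dexp (run Ms Mb X0 A T) (G T).

Lemma le_draft_exp A G H :
  (forall (T : g.-tuple X) o, G T o <= H T o) -> draft_exp A G <= draft_exp A H.
Proof.
move=> GH; apply: ler_sum => T _; apply: ler_wpM2l.
  by rewrite path_probE forced_prob_ge0.
by apply: ler_sum => o _; apply: ler_wpM2l; [exact: Defs.pmf_ge0 | exact: GH].
Qed.

Lemma draft_exp_sum A (I : finType) (G : I -> seq X -> output X g -> R) :
  draft_exp A (fun T o => \sum_i G i T o) = \sum_i draft_exp A (G i).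
Proof.
rewrite /draft_exp exchange_big; apply: eq_bigr => T _; rewrite -mulr_sumr.
congr (_ * _); rewrite /dexp exchange_big; apply: eq_bigr => o _.
by rewrite mulr_sumr.
Qed.

Lemma draft_expD A G H :
  draft_exp A (fun T o => G T o + H T o) = draft_exp A G + draft_exp A H.
Proof.
rewrite /draft_exp -big_split; apply: eq_bigr => T _ /=; rewrite -mulrDr.
by congr (_ * _); rewrite /dexp -big_split; apply: eq_bigr => o _; rewrite mulrDr.
Qed.

Lemma draft_expZ A G c : draft_exp A (fun T o => c * G T o) = c * draft_exp A G.
Proof.
by rewrite /draft_exp mulr_sumr; apply: eq_bigr => T _; rewrite dexpZl mulrCA.
Qed.

Lemma draft_exp_draft A (F : seq X -> R) :
  draft_exp A (fun T _ => F T) = path_mean Ms X0 g F.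
Proof. by apply: eq_bigr => T _; rewrite dexp_cst path_probE. Qed.

(** Tail-sum formula; levels are counted from zero, so [l < o.1] stands for at least [l.+1] accepted
    tokens. *)
Lemma expected_accepted_tails A :
  expected_accepted Ms Mb X0 A =
  \sum_(l < g) draft_exp A (fun _ o => (l < o.1)%N%:R).
Proof.
rewrite -draft_exp_sum; apply: eq_bigr => T _; congr (_ * _).
apply: eq_bigr => o _; congr (_ * _); rewrite -natr_sum -big_mkcond /=.
rewrite -(big_ord_widen _ (fun=> 1%N)) ?sum1_card ?card_ord //.
exact: leq_ord.
Qed.

(** This is the quantity [a(z)] of the opening outline. *)
Definition accepted_mass A s :=
  draft_exp A (fun T o => ((size s <= o.1)%N && (take (size s) T == s))%:R).

(** Exactly one [s] of length [l] is a prefix of the draft. *)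
Lemma accepted_mass_sum A l :
  draft_exp A (fun _ o => (l <= o.1)%N%:R) =
  \sum_(s : l.-tuple X) accepted_mass A s.
Proof.
rewrite -draft_exp_sum; apply: eq_bigr => T _; congr (_ * _).
apply: eq_bigr => o _; congr (_ * _).
have [lo|] := leqP l o.1; last first.
  by move=> ol; rewrite big1 // => s _; rewrite size_tuple leqNgt ol.
have sT : size (take l T) == l.
  apply/eqP/size_takel; rewrite size_tuple; apply: leq_trans lo (leq_ord _).
rewrite (bigD1 (Tuple sT)) //= (eqP sT) lo eqxx big1 ?addr0 // => s.
rewrite size_tuple lo andTb => sne; case: eqP => // e; case/eqP: sne.
exact/val_inj/esym.
Qed.

(** Dropping the acceptance condition leaves the probability that the draft starts with [s]. *)
Lemma accepted_mass_le_seq_prob A s : (size s <= g)%N ->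
  accepted_mass A s <= seq_prob Ms X0 s.
Proof.
move=> sg; apply: (@le_trans _ _ (draft_exp A (fun T _ => (take (size s) T == s)%:R))).
  by apply: le_draft_exp => T o; rewrite ler_nat; case: (size s <= o.1)%N.
rewrite draft_exp_draft (path_mean_take Ms X0 (fun t => (t == s)%:R)) //.
rewrite /path_mean (bigD1 (in_tuple s)) //= eqxx mulr1 big1 ?addr0 // => t.
by rewrite -val_eqE => /negPf /= ->; rewrite mulr0.
Qed.

Hypothesis (A : chain_algorithm R X g) (A_valid : valid Ms Mb X0 A).

Lemma valid_seq_prob s :
  draft_exp A (fun T o => forced_prob Mb X0 (rcons (take o.1 T) o.2) s) =
  seq_prob Mb X0 s.
Proof.
(* [valid] speaks only of positive lengths; for the empty string both sides are 1. *)
have [/size0nil -> /=|s0] := posnP (size s).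
  rewrite (draft_exp_draft A (fun=> 1)) (path_mean_take Ms X0 (fun=> 1) (leq0n g)).
  rewrite /path_mean (big_pred1 [tuple]) ?mulr1 // => t.
  exact/esym/eqP/tuple0.
rewrite -(path_probE Mb X0 (in_tuple s)) -A_valid //.
apply: eq_bigr => T _; congr (_ * _); apply: eq_bigr => o _.
by rewrite continue_probE.
Qed.

(* The continuation after the output is drawn from [Mb], so validity at two
   consecutive lengths forbids extending an accepted prefix faster than [Mb]. *)
Lemma accepted_mass_rcons s x : (size s < g)%N ->
  accepted_mass A (rcons s x) <= accepted_mass A s * Mb (X0 ++ s) x.
Proof.
(* Adding the same term to both sides lets validity rewrite the two path probabilities as draft
   expectations; the inequality then holds pointwise in the draft and the output. *)
move=> sg; rewrite mulrC -(lerD2l (Mb (X0 ++ s) x * seq_prob Mb X0 s)).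
rewrite [in leRHS](mulrC _ (seq_prob _ _ _)) -seq_prob_rcons -!valid_seq_prob.
rewrite /accepted_mass -!draft_expZ -!draft_expD.
apply: le_draft_exp => T o /=.
have b0 : 0 <= Mb (X0 ++ s) x by exact: Defs.pmf_ge0.
have szT : size (take o.1 T) = o.1 by rewrite size_takel // size_tuple leq_ord.
have szo : size (rcons (take o.1 T) o.2) = o.1.+1 by rewrite size_rcons szT.
have [os|so] := ltnP o.1 (size s).
  (* The output ends within [s], so [x] is drawn from [Mb]: equality. *)
  rewrite size_rcons ltnNge (ltnW os) /= mulr0 !addr0 forced_prob_rcons.
  by rewrite onth_default ?szo // mulrC.
have takeE k : (k <= o.1)%N -> take k (rcons (take o.1 T) o.2) = take k T.
  by move=> ko; rewrite -cats1 takel_cat ?take_takel ?szT.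
rewrite (forced_prob_take _ _ (w := rcons _ _) (s := s)) ?szo ?(leqW so) // takeE //=.
rewrite addrC lerD2r size_rcons.
(* If [x] falls within the accepted prefix, both sides are the same indicator; if it is at the place
   of the extra token, the left side is 0. *)
have [so'|_] := ltnP; last by rewrite forced_prob_ge0.
by rewrite forced_prob_take !size_rcons ?szT ?ltnS 1?ltnW // takeE.
Qed.

Lemma accepted_mass_le s : (size s <= g)%N ->
  accepted_mass A s <= seq_prob Ms X0 s * weight Ms Mb X0 s.
Proof.
elim/last_ind: s => [|s x IHs] sg.
  by rewrite [leRHS]mulr1; exact: accepted_mass_le_seq_prob.
rewrite seq_prob_weight_rcons le_min accepted_mass_le_seq_prob // andbT.
rewrite size_rcons in sg.
apply: le_trans (accepted_mass_rcons _ sg) _.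
by apply: ler_wpM2r; [exact: Defs.pmf_ge0 | exact/IHs/ltnW].
Qed.

Lemma accepted_tail_le l : (l <= g)%N ->
  draft_exp A (fun _ o => (l <= o.1)%N%:R) <=
  path_mean Ms X0 l (weight Ms Mb X0).
Proof.
move=> lg; rewrite accepted_mass_sum; apply: ler_sum => s _.
by apply: accepted_mass_le; rewrite size_tuple.
Qed.

End verification.

(** * Both algorithms attain the bound at every level *)

Section chain_verification.
Context {R : realType} {X : finType}.
Variables (Ms Mb : model R X) (X0 : seq X) (g l : nat).
Hypothesis lg : (0 < l <= g)%N.

Lemma traversal_accepted_tail :
  draft_exp Ms Mb X0 (traversal_verification g) (fun _ o => (l <= o.1)%N%:R) =
  path_mean Ms X0 l (weight Ms Mb X0).
Proof.
have /andP[l0 l_le_g] := lg; rewrite -(path_mean_accept_tail _ _ _ l_le_g).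
apply: eq_bigr => T _; rewrite path_probE; congr (_ * _).
by rewrite traversal_tail ?p_init_itv // l_le_g accept_tailE.
Qed.

Lemma block_accepted_tail :
  draft_exp Ms Mb X0 (block_verification g) (fun _ o => (l <= o.1)%N%:R) =
  path_mean Ms X0 l (weight Ms Mb X0).
Proof.
have /andP[_ l_le_g] := lg; rewrite -(path_mean_accept_tail _ _ _ l_le_g).
apply: eq_bigr => T _; rewrite path_probE; congr (_ * _).
by rewrite block_tail // accept_tailE.
Qed.

End chain_verification.

Theorem theorem3p4 (R : realType) (X : finType) (Ms Mb : model R X)
    (X0 : seq X) (g : nat) (g_ge1 : (1 <= g)%N)
    (verify : chain_algorithm R X g) (verify_valid : valid Ms Mb X0 verify) :
  expected_accepted Ms Mb X0 (traversal_verification g) =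
    expected_accepted Ms Mb X0 (block_verification g) /\
  expected_accepted Ms Mb X0 (block_verification g) >=
    expected_accepted Ms Mb X0 verify.
Proof.
rewrite !expected_accepted_tails; split.
  apply: eq_bigr => l _.
  by rewrite traversal_accepted_tail ?block_accepted_tail ?ltn_ord.
apply: ler_sum => l _; rewrite block_accepted_tail ?ltn_ord //.
exact: accepted_tail_le.
Qed.
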